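(* Let $n\geq 3$ be an integer and $J$ a $\phi_n$-injective, weakly connected quiver. If $J$ has a walk of length $n-1$, then $J$ is a blow-up of $C_\ell$ for some positive integer $\ell$ dividing $n$.
   Context: A quiver is a quadruple $(V,E,\sigma,\tau)$ with $V,E$ sets and $\sigma,\tau:E\to V$ functions (source and target); an edge $e$ goes from $\sigma(e)$ to $\tau(e)$; quiver homomorphisms are pairs of vertex and edge maps commuting with sources and targets. For $v,w\in V(J)$, $\mathrm{edges}_J(v,w):=\sigma_J^{-1}(v)\cap\tau_J^{-1}(w)$. A walk of length $k$ is a sequence of vertices $v_1,\dots,v_{k+1}$ with edges $e_i\in\mathrm{edges}_J(v_i,v_{i+1})$. $J$ is weakly connected if any two vertices are joined by a finite sequence of edges, each traversed in either direction. For $m\geq 1$, the directed cycle $C_m$ has vertices $a_1,\dots,a_m$ and edges $x_1,\dots,x_m$ with $x_k$ from $a_k$ to $a_{k+1}$ (indices mod $m$); in particular $C_1$ is a single vertex with a single loop. The directed path $P_n$ has vertices $a_1,\dots,a_n$ and edges $x_1,\dots,x_{n-1}$ with $x_k$ from $a_k$ to $a_{k+1}$, and $\phi_n:P_n\to C_n$ is the inclusion. $J$ is $\phi_n$-injective if for every quiver homomorphism $\psi:P_n\to J$ there is a quiver homomorphism $\hat\psi:C_n\to J$ with $\hat\psi\circ\phi_n=\psi$. A blow-up of a quiver $G$ is a quiver $H$ equipped with partitions (families of pairwise disjoint subsets with union the whole set) $(A_v)_{v\in V(G)}$ of $V(H)$ and $(B_e)_{e\in E(G)}$ of $E(H)$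 such that for all $e\in E(G)$, $f\in B_e$, $x\in A_{\sigma_G(e)}$, $y\in A_{\tau_G(e)}$: $\sigma_H(f)\in A_{\sigma_G(e)}$, $\tau_H(f)\in A_{\tau_G(e)}$, and $\mathrm{edges}_H(x,y)\cap B_e\neq\emptyset$. *)

(* Defs.v *)
From Stdlib Require Import Relations.
From mathcomp Require Import all_boot.
From mathcomp Require Import boolp classical_sets.

Set Implicit Arguments.
Unset Strict Implicit.
Unset Printing Implicit Defensive.

Local Open Scope classical_set_scope.

Record quiver := Quiver {
  vert : Type;
  edge : Type;
  src : edge -> vert;
  tgt : edge -> vert
}.
Arguments src {q} e : rename.
Arguments tgt {q} e : rename.

Record qhom (G H : quiver) := QHom {
  vmap : vert G -> vert H;
  emap : edge G -> edge H;
  qhom_src : forall e, src (emap e) = vmap (src e);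
  qhom_tgt : forall e, tgt (emap e) = vmap (tgt e)
}.

(* Equality of homomorphisms is equality of both underlying maps. *)
Definition qhom_eq (G H : quiver) (f g : qhom G H) : Prop :=
  vmap f =1 vmap g /\ emap f =1 emap g.

Lemma qhom_comp_src (G H K : quiver) (g : qhom H K) (f : qhom G H) e :
  src ((emap g \o emap f) e) = (vmap g \o vmap f) (src e).
Proof. by rewrite /= !qhom_src. Qed.

Lemma qhom_comp_tgt (G H K : quiver) (g : qhom H K) (f : qhom G H) e :
  tgt ((emap g \o emap f) e) = (vmap g \o vmap f) (tgt e).
Proof. by rewrite /= !qhom_tgt. Qed.

Definition qhom_comp (G H K : quiver) (g : qhom H K) (f : qhom G H) :
    qhom G K :=
  QHom (qhom_comp_src g f) (qhom_comp_tgt g f).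

Definition edges (J : quiver) (v w : vert J) : set (edge J) :=
  src @^-1` [set v] `&` tgt @^-1` [set w].

Definition has_walk (J : quiver) (k : nat) : Prop :=
  exists (v : 'I_k.+1 -> vert J) (e : 'I_k -> edge J),
    forall i : 'I_k, edges (v (widen_ord (leqnSn k) i)) (v (lift ord0 i)) (e i).

Definition weak_adj (J : quiver) (v w : vert J) : Prop :=
  exists e : edge J, edges v w e \/ edges w v e.

Definition weakly_connected (J : quiver) : Prop :=
  forall v w : vert J, clos_refl_trans (vert J) (@weak_adj J) v w.

(* Vertices and edges are numbered from 0: ordS is i |-> i.+1 %% m.
   The directed cycle is only meaningful for m >= 1. *)
Definition dicycle (m : nat) : quiver :=
  @Quiver 'I_m 'I_m id (@ordS m).

Lemma dipath_tgt_subproof (n : nat) (i : 'I_n.-1) : i.+1 < n.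
Proof. by case: n i => [|n] [i]. Qed.

Definition dipath (n : nat) : quiver :=
  @Quiver 'I_n 'I_n.-1 (widen_ord (leq_pred n))
    (fun i => Ordinal (dipath_tgt_subproof i)).

Lemma phi_src (n : nat) (e : edge (dipath n)) :
  @src (dicycle n) (widen_ord (leq_pred n) e) = src e.
Proof. by []. Qed.

Lemma phi_tgt (n : nat) (e : edge (dipath n)) :
  @tgt (dicycle n) (widen_ord (leq_pred n) e) = tgt e.
Proof. by apply: val_inj; rewrite /= modn_small ?dipath_tgt_subproof. Qed.

Definition phi (n : nat) : qhom (dipath n) (dicycle n) :=
  @QHom (dipath n) (dicycle n) id (widen_ord (leq_pred n))
    (@phi_src n) (@phi_tgt n).

Definition phi_injective (n : nat) (J : quiver) : Prop :=
  forall psi : qhom (dipath n) J,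
    exists psi_hat : qhom (dicycle n) J, qhom_eq (qhom_comp psi_hat (phi n)) psi.

(* Parts may be empty, unlike in classical_sets.partition. *)
Definition set_partition (I T : Type) (A : I -> set T) : Prop :=
  trivIset setT A /\ \bigcup_i A i = setT.

(* Each condition quantifies only over the variables it mentions: since parts
   may be empty, one joint quantification over f, x and y would make all the
   conditions at e vacuous as soon as B e, A (src e) or A (tgt e) is empty. *)
Definition is_blowup (G H : quiver) : Prop :=
  exists (A : vert G -> set (vert H)) (B : edge G -> set (edge H)),
    [/\ set_partition A,
        set_partition B,
        forall (e : edge G) (f : edge H),
          B e f -> A (src e) (src f) /\ A (tgt e) (tgt f) &
        forall (e : edge G) (x y : vert H),
          A (src e) x -> A (tgt e) y -> edges x y `&` B e !=set0].

(* Main.v *)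
Require Import Defs.
From Stdlib Require Import Relations.
From mathcomp Require Import all_boot.
From mathcomp Require Import boolp classical_sets zify.

(** Let [E] be the adjacency relation of [J] and [m = n - 1]. Injectivity says
    that [E^m] is contained in the converse of [E]. A closed walk of length [n]
    through [x] can be rerouted through any neighbour of [x], so by connectivity
    [E^n] is reflexive, and the rerouting also shows [E^m] to be equal to the
    converse of [E]. Hence [E = E^(m^2)], which contains [E^(n+1)], and the
    positive powers of [E] only depend on the exponent modulo [n]. Fixing a
    vertex [o], the exponents [k] with [E^k o o] are the multiples of some
    [l %| n], and sending a vertex to the length modulo [l] of the walks
    reaching it from [o] gives a homomorphism to [C_l] whose fibres are the
    parts of the blow-up. *)

Set Implicit Arguments.
Unset Strict Implicit.
Unset Printing Implicit Defensive.

Lemma nat_subgroup_dvdn (P : nat -> Prop) (n : nat) :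
    0 < n -> P n -> (forall a b, P a -> (P (a + b) <-> P b)) ->
  exists l, [/\ 0 < l, l %| n & forall k, P k <-> l %| k].
Proof.
move=> n_gt0 Pn PD.
have [|l /andP[l_gt0 /asboolP Pl] l_min] :=
  @ex_minnP (fun l => (0 < l) && `[< P l >]).
  by exists n; rewrite n_gt0; apply/asboolP.
have P0 : P 0 by apply/(PD n 0 Pn); rewrite addn0.
have P_mul t : P (t * l) by elim: t => // t P_tl; rewrite mulSn; apply/PD.
have P_dvd k : P k <-> l %| k.
  split=> [|/dvdnP[t ->] //]; rewrite {1}(divn_eq k l) => /PD-/(_ (P_mul _)) Pr.
  rewrite /dvdn eqn0Ngt; apply/negP => r_gt0.
  have /l_min : (0 < k %% l) && `[< P (k %% l) >].
    by rewrite r_gt0; apply/asboolP.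
  by rewrite leqNgt ltn_pmod.
by exists l; split=> //; apply/P_dvd.
Qed.

Section RelationPowers.

Variable T : Type.
Implicit Types (E F : relation T) (x y z : T).

Fixpoint relpow E (k : nat) x y : Prop :=
  if k is k'.+1 then exists2 z, E x z & relpow E k' z y else x = y.

Lemma relpow1 E x y : relpow E 1 x y <-> E x y.
Proof. by split=> [[z Exz <-]|Exy] //; exists y. Qed.

Lemma relpowD E a b x y :
  relpow E (a + b) x y <-> exists2 z, relpow E a x z & relpow E b z y.
Proof.
elim: a x => [|a IH] x /=; first by split=> [?|[z ->]] //; exists x.
split=> [[w Exw /IH[z wz zy]]|[z [w Exw wz] zy]].
  by exists z => //; exists w.
by exists w => //; apply/IH; exists z.
Qed.

Lemma relpow_cat E a b x y z :
  relpow E a x y -> relpow E b y z -> relpow E (a + b) x z.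
Proof. by move=> xy yz; apply/relpowD; exists y. Qed.

Lemma relpow_rcons E k x y z : relpow E k x y -> E y z -> relpow E k.+1 x z.
Proof. by rewrite -addn1 => xy Eyz; apply: relpow_cat xy _; apply/relpow1. Qed.

Lemma relpowM E a b x y : relpow (relpow E a) b x y <-> relpow E (b * a) x y.
Proof.
elim: b x => [|b IH] x //=; rewrite mulSn.
split=> [[z xz /IH zy]|/relpowD[z xz /IH zy]]; last by exists z.
exact: relpow_cat xz zy.
Qed.

Lemma relpow_loopM E k t x : relpow E k x x -> relpow E (t * k) x x.
Proof.
by move=> xx; elim: t => [|t IH] //; rewrite mulSn; apply: relpow_cat xx IH.
Qed.

Lemma relpow_converse E F m k x y :
    (forall u v, E u v -> relpow F m v u) ->
  relpow E k x y -> relpow F (k * m) y x.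
Proof.
move=> EF; elim: k x => [|k IH] x /= => [->|[z /EF zx /IH yz]] //.
by rewrite mulSn addnC; apply: relpow_cat yz zx.
Qed.

Lemma relpow_transp E k x y : relpow (transp T E) k x y <-> relpow E k y x.
Proof.
split=> /(@relpow_converse _ _ 1); rewrite muln1; apply=> u v Euv;
  exact/relpow1.
Qed.

Lemma relpowP E k x y :
  relpow E k x y <->
  exists v : nat -> T,
    [/\ v 0 = x, v k = y & forall i, i < k -> E (v i) (v i.+1)].
Proof.
split; last first.
  case=> v [<- <-]; elim: k v => [|k IH] v Ev //=.
  by exists (v 1); [exact: Ev | apply: (IH (v \o succn)) => i ik; apply: Ev].
elim: k x => [|k IH] x /=; first by move=> ->; exists (fun=> y).
case=> z Exz /IH[v [v0 vk Ev]].
exists (fun i => if i is j.+1 then v j else x); split=> // -[|i] ik.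
  by rewrite v0.
exact: Ev.
Qed.

End RelationPowers.

Section WalkClosing.

Variable T : Type.
Implicit Types (E : relation T) (x y z : T).

Definition walk_closing E (m : nat) : Prop :=
  forall x y, relpow E m x y -> E y x.

Lemma walk_closing_transp E m : walk_closing E m -> walk_closing (transp T E) m.
Proof. by move=> E_closing x y /relpow_transp/E_closing. Qed.

(* If [x -> w -> z -> ... -> x] is the closed walk, then the walk
   [z -> ... -> x -> y] closes up with an edge [y -> z]. *)
Lemma walk_closing_reroute E m x y :
    0 < m -> walk_closing E m -> relpow E m.+1 x x -> E x y ->
  relpow E m y x.
Proof.
case: m => // m _ E_closing [w _ [z _ zx]] Exy.
by exists z => //; apply: E_closing; apply: relpow_rcons zx Exy.
Qed.

Lemma walk_closing_loop_adj E m x y :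
    0 < m -> walk_closing E m -> relpow E m.+1 x x -> E x y ->
  relpow E m.+1 y y.
Proof.
move=> m_gt0 E_closing xx Exy.
exact: relpow_rcons (walk_closing_reroute m_gt0 E_closing xx Exy) Exy.
Qed.

Lemma walk_closing_loop_conn E m x y :
    0 < m -> walk_closing E m -> clos_refl_sym_trans T E x y ->
  relpow E m.+1 x x <-> relpow E m.+1 y y.
Proof.
move=> m_gt0 E_closing; elim=> {x y} [x y Exy|//|x y _ <- //|x y z _ -> _ //].
split=> [xx|/relpow_transp yy]; first exact: walk_closing_loop_adj xx Exy.
apply/relpow_transp; apply: walk_closing_loop_adj yy Exy => //.
exact: walk_closing_transp.
Qed.

Lemma walk_closing_sqr E m x y :
  walk_closing E m -> relpow E (m * m) x y -> E x y.
Proof.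
move=> E_closing /relpowM xy; apply: (E_closing); rewrite -[m]muln1.
by apply: relpow_converse xy => u v /E_closing/relpow1.
Qed.

End WalkClosing.

Definition cyclic_grading (T : Type) (E : relation T) (l : nat) (d : T -> nat) :
    Prop :=
  forall x y, E x y <-> d y = (d x).+1 %[mod l].

Section ConnectedClosing.

Variables (T : Type) (E : relation T) (m : nat) (o : T).
Hypotheses (m_gt1 : 1 < m) (E_closing : walk_closing E m).
Hypothesis E_conn : forall x y, clos_refl_sym_trans T E x y.
Hypothesis o_loop : relpow E m.+1 o o.

Let m_gt0 : 0 < m := ltnW m_gt1.

Lemma relpow_loop_all x : relpow E m.+1 x x.
Proof. by apply/(walk_closing_loop_conn m_gt0 E_closing (E_conn o x)). Qed.

Lemma relpow_rev k x y : relpow E k x y -> relpow E (k * m) y x.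
Proof.
apply: relpow_converse => u v; apply: walk_closing_reroute => //.
exact: relpow_loop_all.
Qed.

Lemma relpow_reach x y : exists k, relpow E k x y.
Proof.
elim: (E_conn x y) => {x y} [x y Exy|x|x y _ [k xy]|x y z _ [a xy] _ [b yz]].
- by exists 1; apply/relpow1.
- by exists 0.
- by exists (k * m); apply: relpow_rev.
- by exists (a + b); apply: relpow_cat xy yz.
Qed.

Lemma relpow_drop1 x y : relpow E m.+2 x y -> E x y.
Proof.
move=> xy; apply: (walk_closing_sqr E_closing).
have -> : m * m = (m - 2) * m.+1 + m.+2 by nia.
by apply: relpow_cat xy; apply/relpow_loopM/relpow_loop_all.
Qed.

Lemma relpow_drop k t x y :
  0 < k -> relpow E (k + t * m.+1) x y -> relpow E k x y.
Proof.
case: k => // k _; elim: t => [|t IH]; first by rewrite addn0.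
have -> : k.+1 + t.+1 * m.+1 = m.+2 + (k + t * m.+1) by lia.
by case/relpowD=> z /relpow_drop1 Exz zy; apply: IH; exists z.
Qed.

Lemma relpow_eqmod a b x y :
  0 < b -> a = b %[mod m.+1] -> relpow E a x y -> relpow E b x y.
Proof.
move=> b_gt0 ab xy; apply: (@relpow_drop _ (a %/ m.+1)) => //.
have -> : b + a %/ m.+1 * m.+1 = b %/ m.+1 * m.+1 + a.
  by rewrite [in LHS](divn_eq b m.+1) -ab addnAC -addnA -divn_eq.
by apply: relpow_cat xy; apply/relpow_loopM/relpow_loop_all.
Qed.

Lemma relpow_loopD a b :
  relpow E a o o -> relpow E (a + b) o o <-> relpow E b o o.
Proof.
move=> a_loop; split=> [ab_loop|]; last exact: relpow_cat.
have [-> //|b_gt0] := posnP b; apply: (@relpow_eqmod (a * m + (a + b))) => //.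
  by rewrite addnA -mulnSr modnMDl.
by apply: relpow_cat ab_loop; apply: relpow_rev.
Qed.

Section Period.

Variable l : nat.
Hypotheses (l_dvd : l %| m.+1) (l_period : forall k, relpow E k o o <-> l %| k).

Lemma relpow_period_eqmod a b x :
  relpow E a o x -> relpow E b o x -> a = b %[mod l].
Proof.
move=> oa /relpow_rev xo; have /l_period l_dvd_loop := relpow_cat oa xo.
apply/eqP; rewrite -(eqn_modDr (b * m)) -mulnS.
by rewrite (eqP l_dvd_loop) (eqP (dvdn_mull b l_dvd)).
Qed.

Lemma relpow_eqmod_period a b x :
  0 < b -> a = b %[mod l] -> relpow E a o x -> relpow E b o x.
Proof.
move=> b_gt0 ab oa; apply: (@relpow_eqmod (b + a * m + a)) => //.
  by rewrite -addnA -mulnSr addnC modnMDl.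
apply: relpow_cat oa; apply/l_period.
by rewrite /dvdn -modnDml -ab modnDml -mulnS; apply: dvdn_mull.
Qed.

Lemma relpow_cyclic_grading (d : T -> nat) :
  (forall x, relpow E (d x) o x) -> cyclic_grading E l d.
Proof.
move=> od x y; split=> [Exy|dxy].
  exact: relpow_period_eqmod (od y) (relpow_rcons (od x) Exy).
apply/relpow1; apply: (@relpow_eqmod (d x * m + (d x).+1)) => //.
  by rewrite -addn1 addnA -mulnSr modnMDl.
apply: relpow_cat (relpow_rev (od x)) _.
exact: relpow_eqmod_period dxy (od y).
Qed.

End Period.

Theorem walk_closing_cyclic_grading :
  exists l d, [/\ 0 < l, l %| m.+1 & cyclic_grading E l d].
Proof.
have [l [l_gt0 l_dvd l_period]] :=
  nat_subgroup_dvdn (ltn0Sn m) o_loop relpow_loopD.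
have [d od] := choice (relpow_reach o).
by exists l, d; split=> //; apply: relpow_cyclic_grading.
Qed.

End ConnectedClosing.

Section Quivers.

Implicit Types G H J : quiver.

Definition adj J : relation (vert J) := fun x y => exists e, edges x y e.

Lemma weakly_connected_adj J :
  weakly_connected J -> forall x y, clos_refl_sym_trans _ (@adj J) x y.
Proof.
move=> J_conn x y.
elim: (J_conn x y) => {x y} [x y [e []]|x|x y z _ IHxy _ IHyz].
- by move=> xy; apply: rst_step; exists e.
- by move=> yx; apply/rst_sym/rst_step; exists e.
- exact: rst_refl.
- exact: rst_trans IHxy IHyz.
Qed.

Lemma has_walk_relpow J k : has_walk J k -> exists x y, relpow (@adj J) k x y.
Proof.
case=> v [e ve]; exists (v (inord 0)), (v (inord k)); apply/relpowP.
exists (v \o inord); split=> // i ik; exists (e (Ordinal ik)).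
have := ve (Ordinal ik); congr (edges (v _) (v _) _); apply: val_inj => /=;
  by rewrite inordK // ltnS // ltnW.
Qed.

Lemma phi_injective_walk_closing J m :
  phi_injective m.+1 J -> walk_closing (@adj J) m.
Proof.
move=> J_inj _ _ /relpowP[v [<- <- Ev]].
have /choice[e ve] (i : 'I_m) : exists f, edges (v i) (v i.+1) f by exact: Ev.
have e_src (i : edge (dipath m.+1)) : src (e i) = v (val (src i)).
  by have [] := ve i.
have e_tgt (i : edge (dipath m.+1)) : tgt (e i) = v (val (tgt i)).
  by have [] := ve i.
pose walk := @QHom (dipath m.+1) J (fun i : 'I_m.+1 => v i) e e_src e_tgt.
have [cycle [cycle_v _]] := J_inj walk.
exists (emap cycle ord_max); split=> /=.
  by rewrite qhom_src; apply: (cycle_v ord_max).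
rewrite qhom_tgt -[RHS](cycle_v ord0) /=; congr (vmap cycle _).
by apply: val_inj; rewrite /= modnn.
Qed.

Lemma fibers_set_partition (I T : Type) (f : T -> I) :
  set_partition (fun i => f @^-1` [set i])%classic.
Proof.
split; first exact: trivIset_preimage1.
by apply/seteqP; split=> // x _; exists (f x).
Qed.

Lemma qhom_full_blowup G H (h : qhom H G) :
    (forall e x y, vmap h x = src e -> vmap h y = tgt e ->
      exists2 f, edges x y f & emap h f = e) ->
  is_blowup G H.
Proof.
move=> h_full.
exists (fun v => vmap h @^-1` [set v])%classic.
exists (fun e => emap h @^-1` [set e])%classic.
split; [exact: fibers_set_partition | exact: fibers_set_partition | |].
- by move=> _ f <-; split; rewrite /= ?qhom_src ?qhom_tgt.
- by move=> e x y hx hy; have [f xy_f hf] := h_full e x y hx hy; exists f.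
Qed.

Lemma cyclic_grading_blowup J l d :
  0 < l -> cyclic_grading (@adj J) l d -> is_blowup (dicycle l) J.
Proof.
move=> l_gt0 d_grading.
pose class x : 'I_l := Ordinal (ltn_pmod (d x) l_gt0).
have adj_class x y : adj x y <-> class y = ordS (class x).
  have ordS_class : ordS (class x) = (d x).+1 %% l :> nat.
    by rewrite /= -[(d x %% l).+1]addn1 modnDml addn1.
  split=> [/d_grading dxy|yx].
    by apply: val_inj; apply: etrans dxy (esym ordS_class).
  by apply/d_grading; rewrite -ordS_class -yx.
have class_tgt (f : edge J) : ordS (class (src f)) = class (tgt f).
  by symmetry; apply/adj_class; exists f.
pose h := @QHom J (dicycle l) class (class \o src) (fun=> erefl) class_tgt.
apply: (@qhom_full_blowup _ _ h) => i x y /= xi yi.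
have /adj_class[f xy_f] : class y = ordS (class x) by rewrite xi.
by exists f => //; case: xy_f => -> _.
Qed.

End Quivers.

Theorem theorem6p1 (n : nat) (J : quiver) (hn : 3 <= n)
    (hinj : phi_injective n J) (hconn : weakly_connected J)
    (hwalk : has_walk J (n - 1)) :
  exists l : nat, [/\ 0 < l, l %| n & is_blowup (dicycle l) J].
Proof.
case: n hn hinj hwalk => // m m_gt1 /phi_injective_walk_closing J_closing.
rewrite subn1 => /has_walk_relpow[o [y oy]].
have o_loop : relpow (@adj J) m.+1 o o := relpow_rcons oy (J_closing _ _ oy).
have [l [d [l_gt0 l_dvd d_grading]]] := walk_closing_cyclic_grading
  m_gt1 J_closing (weakly_connected_adj hconn) o_loop.
by exists l; split=> //; apply: cyclic_grading_blowup d_grading.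
Qed.
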